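(* Let $n\ge 1$ be an integer. For every $0<s<1$ and for every $x\in\mathbb R^n$ and $t>0$ we have $$G^{(s)}(x,t)\ge 0 .$$
   Context: $G^{(s)}$ is the heat kernel of the fractional heat operator $\partial_t+(-\Delta)^s$ in $\mathbb R^n$, i.e. the function $$G^{(s)}(x,t)=\int_{\mathbb R^n}e^{-2\pi i\langle x,\xi\rangle}\,e^{-t(2\pi|\xi|)^{2s}}\,d\xi,\qquad x\in\mathbb R^n,\ t>0 .$$ *)

(* Defs.v *)
From HB Require Import structures.
From mathcomp Require Import all_boot all_order all_algebra.
From mathcomp Require Import complex.
From mathcomp Require Import all_classical all_reals all_analysis.

Set Implicit Arguments.
Unset Strict Implicit.
Unset Printing Implicit Defensive.

Import Order.TTheory GRing.Theory Num.Theory.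
Import numFieldNormedType.Exports.

Local Open Scope classical_set_scope.
Local Open Scope ring_scope.

(* Points of R^n are n-tuples, for which the library provides the product
   sigma-algebra. The norm that it puts on 'rV[R]_n is the sup norm. *)
Section euclidean.
Variables (R : realType) (n : nat).
Implicit Types x y : n.-tuple R.

Definition dotp x y : R := \sum_(i < n) tnth x i * tnth y i.

Definition enorm x : R := Num.sqrt (dotp x x).

End euclidean.

Lemma sigma_finite_product d1 d2 (T1 : measurableType d1)
    (T2 : measurableType d2) (R : realType)
    (m1 : {sigma_finite_measure set T1 -> \bar R})
    (m2 : {sigma_finite_measure set T2 -> \bar R}) :
  sigma_finite setT (m1 \x m2)%E.
Proof.
have /sigma_finiteP[F [TF ndF Foo]] := sigma_finiteT m1.
have /sigma_finiteP[G [TG ndG Goo]] := sigma_finiteT m2.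
exists (fun n => F n `*` G n).
  rewrite -setXTT TF TG; apply/seteqP; split => -[x y] /=.
    move=> [[n _ Fnx] [k _ Gky]]; exists (maxn n k) => //; split.
    - by move: x Fnx; exact/subsetPset/ndF/leq_maxl.
    - by move: y Gky; exact/subsetPset/ndG/leq_maxr.
  by move=> [n _ []/= ? ?]; split; exists n.
move=> k; have [? ?] := Foo k; have [? ?] := Goo k.
split; first exact: measurableX.
by rewrite product_measure1E// lte_mul_pinfty// ge0_fin_numE.
Qed.

Section lebesgue_tuple.
Variable R : realType.
(* The domain of lebesgue_measure: R with its Borel sets, but under a measure
   display different from that of the default instance on R. *)
Local Notation Rm := (measurableTypeR R).

Definition tcons n (p : Rm * n.-tuple Rm) : n.+1.-tuple Rm := [tuple of p.1 :: p.2].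

Definition tuncons n (x : n.+1.-tuple Rm) : Rm * n.-tuple Rm :=
  (thead x, [tuple of behead x]).

Lemma tconsK n : cancel (@tcons n) (@tuncons n).
Proof. by move=> [a v]; congr pair; apply/val_inj. Qed.

Lemma tunconsK n : cancel (@tuncons n) (@tcons n).
Proof. by move=> x; rewrite /tcons/= -tuple_eta. Qed.

Lemma measurable_tcons n : measurable_fun [set: Rm * n.-tuple Rm] (@tcons n).
Proof. exact: measurable_cons. Qed.

Lemma measurable_tuncons n : measurable_fun [set: n.+1.-tuple Rm] (@tuncons n).
Proof.
apply/measurable_fun_pairP; split.
  exact: measurable_tnth.
exact: measurable_behead.
Qed.

(* Lebesgue measure on R^n: the image under R * R^n ~ R^n.+1 of the iterated
   product measure, starting from the unit mass on the one-point space R^0. *)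
Fixpoint lebesgue_tuple (n : nat) : set (n.-tuple Rm) -> \bar R :=
  if n is m.+1 then
    pushforward (lebesgue_measure \x @lebesgue_tuple m)%E (@tcons m)
  else \d_[tuple].

Lemma lebesgue_tuple_spec n :
  exists m : {sigma_finite_measure set (n.-tuple Rm) -> \bar R},
    m = @lebesgue_tuple n :> (set _ -> _).
Proof.
elim: n => [|n [m mE]].
  by exists [the {sigma_finite_measure set (0.-tuple Rm) -> \bar R} of \d_[tuple]].
pose p : {measure set (Rm * n.-tuple Rm)%type -> \bar R} :=
  (@lebesgue_measure R \x m)%E.
pose q : {measure set (n.+1.-tuple Rm) -> \bar R} :=
  measure_function_pushforward__canonical__measure_function_Measure p
    (@measurable_tcons n).
have qfin : sigma_finite setT q.
  have [F TF mF] := sigma_finite_product (@lebesgue_measure R) m.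
  exists (fun k => @tuncons n @^-1` F k).
    by rewrite -preimage_bigcup -TF preimage_setT.
  move=> k; have [mFk Fkoo] := mF k; split.
    by rewrite -[X in measurable X]setTI; exact: measurable_tuncons.
  rewrite /q /= /pushforward -comp_preimage.
  by rewrite (_ : _ \o _ = id) ?preimage_id//; apply/funext => z; exact: tconsK.
pose b := Measure_isSigmaFinite.Build _ _ _ (q : set _ -> \bar R) qfin.
pose q' : {sigma_finite_measure set (n.+1.-tuple Rm) -> \bar R} :=
  HB.pack (q : set _ -> \bar R) q b.
by exists q'; rewrite /q'/= mE.
Qed.

Let lebesgue_tuple_0 n : @lebesgue_tuple n set0 = 0%E.
Proof. by have [m <-] := lebesgue_tuple_spec n; exact: measure0. Qed.

Let lebesgue_tuple_ge0 n A : (0 <= @lebesgue_tuple n A)%E.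
Proof. by have [m <-] := lebesgue_tuple_spec n; exact: measure_ge0. Qed.

Let lebesgue_tuple_sigma_additive n : semi_sigma_additive (@lebesgue_tuple n).
Proof.
by have [m <-] := lebesgue_tuple_spec n; exact: measure_semi_sigma_additive.
Qed.

HB.instance Definition _ n := isMeasure.Build _ _ _ (@lebesgue_tuple n)
  (@lebesgue_tuple_0 n) (@lebesgue_tuple_ge0 n)
  (@lebesgue_tuple_sigma_additive n).

Let lebesgue_tuple_sigma_finite n : sigma_finite setT (@lebesgue_tuple n).
Proof. by have [m <-] := lebesgue_tuple_spec n; exact: sigma_finiteT. Qed.

HB.instance Definition _ n := Measure_isSigmaFinite.Build _ _ _
  (@lebesgue_tuple n) (@lebesgue_tuple_sigma_finite n).

Lemma measurable_box n (A : 'I_n -> set R) :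
  (forall i, measurable (A i)) ->
  measurable [set x : n.-tuple Rm | forall i, A i (tnth x i)].
Proof.
move=> mA; rewrite (_ : [set _ | _] =
    \big[setI/setT]_(i < n) ((fun x : n.-tuple Rm => tnth x i) @^-1` A i)).
  apply: bigsetI_measurable => i _.
  by rewrite -[X in measurable X]setTI; apply: measurable_tnth => //; exact: mA.
rewrite -bigcap_seq; apply/seteqP; split => x /= xA i.
  by move=> _; exact: xA.
by apply: xA; rewrite /= mem_index_enum.
Qed.

Lemma lebesgue_tuple_box n (A : 'I_n -> set R) :
  (forall i, measurable (A i)) ->
  lebesgue_tuple [set x : n.-tuple Rm | forall i, A i (tnth x i)] =
  (\prod_(i < n) lebesgue_measure (A i))%E.
Proof.
elim: n A => [|n IH] A mA.
  rewrite big_ord0 (_ : [set _ | _] = setT); first exact: diracT.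
  by apply/seteqP; split => // x _ [].
rewrite big_ord_recl -IH; last by move=> i; exact: mA.
rewrite -product_measure1E; last 2 first.
- exact: mA.
- exact: (@measurable_box n (fun i => A (lift ord0 i)) (fun i => mA _)).
rewrite /pushforward; congr product_measure1.
apply/seteqP; split => -[a v] /=.
  move=> avA; split => [|i]; first exact: (avA ord0).
  by have := avA (lift ord0 i); rewrite tnthS.
move=> [aA vA] i; case: (unliftP ord0 i) => [j ->|->]; last exact: aA.
by rewrite tnthS.
Qed.

End lebesgue_tuple.

Section complex_analysis.
Variable R : realType.
Local Open Scope complex_scope.

Definition cexp (z : R[i]) : R[i] :=
  (expR (complex.Re z))%:C * (cos (complex.Im z) +i* sin (complex.Im z)).

(* As for Rintegral, the value is meaningful when Re f and Im f are integrable,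
   which is the case below for 0 < s and 0 < t. *)
Definition cintegral d (T : measurableType d) (mu : {measure set T -> \bar R})
    (f : T -> R[i]) : R[i] :=
  Rintegral mu setT (fun x => complex.Re (f x)) +i*
  Rintegral mu setT (fun x => complex.Im (f x)).

End complex_analysis.

Section fractional_heat_kernel.
Variables (R : realType) (n : nat).
Local Open Scope complex_scope.

Definition fractional_heat_kernel (s : R) (x : n.-tuple R) (t : R) : R[i] :=
  cintegral (@lebesgue_tuple R n) (fun xi : n.-tuple (measurableTypeR R) =>
    cexp (- (2 * pi * dotp x xi)%:C * 'i%C) *
    cexp (- (t * (2 * pi * enorm xi) `^ (2 * s))%:C)).

End fractional_heat_kernel.

(* Main.v *)
Require Import Defs.
From mathcomp Require Import all_boot all_order all_algebra.
From mathcomp Require Import complex.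
From mathcomp Require Import all_classical all_reals all_analysis.
From mathcomp Require Import measurable_realfun ring lra.

Import Order.TTheory GRing.Theory Num.Theory.
Import numFieldNormedType.Exports.
Local Open Scope classical_set_scope.
Local Open Scope ring_scope.

(* Call a bounded function a multiplier if multiplication by it preserves the
   functions g such that the integral of cos <b, xi> exp (- e |xi|^2) g(xi) is
   nonnegative for all e > 0. Gaussians are multipliers, since they only shift e
   and have nonnegative Fourier transforms. Multipliers are closed under sums,
   products, bounded pointwise limits and exponentials, so the functions psi for
   which all exp (- t psi), t >= 0, are multipliers form a closed convex cone.
   This cone contains 1 - exp (- a |xi|^2), hence also
     psi_h = sum over j in Z of exp (- j h s) (1 - exp (- |xi|^2 exp (j h))).
   As a function of l = |xi|^2, psi_h is monotone and is multiplied by exp (h s)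
   when l is multiplied by exp h, so psi_h (l) / psi_h (1) tends to l^s as h tends
   to 0. This discrete subordination replaces the formula for l^s as an integral.
   The sine integrals are treated in the same way, with both signs, and vanish. *)

(** * Powers as limits of exponential sums *)

Section power_as_exponential_sum.
Context {R : realType}.
Variable s : R.
Hypotheses (s_gt0 : 0 < s) (s_lt1 : s < 1).
Implicit Types u l h x y : R.

(** After the substitution [r = expR u], this is the integrand of the Levy-Khintchine formula, which
    writes l^s up to a constant as the integral over r > 0 of (1 - exp (- l r)) r^(- 1 - s). *)
Definition levy_term u l := expR (- (u * s)) * (1 - expR (- (l * expR u))).

Lemma levy_term_ge0 u l : 0 <= l -> 0 <= levy_term u l.
Proof.
by move=> l0; rewrite mulr_ge0 ?expR_ge0// subr_ge0 expR_le1 oppr_le0 mulr_ge0 ?expR_ge0.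
Qed.

Lemma levy_term_le u l : levy_term u l <= expR (- (u * s)).
Proof. by rewrite ler_piMr ?expR_ge0// gerBl expR_ge0. Qed.

(** From 1 - exp (- y) <= y. Since s < 1, this bound decays as [u] tends to minus infinity, whereas
    [levy_term_le] decays at plus infinity. *)
Lemma levy_term_le_linear u l : levy_term u l <= l * expR (u * (1 - s)).
Proof.
have -> : l * expR (u * (1 - s)) = expR (- (u * s)) * (l * expR u).
  by rewrite mulrBr mulr1 expRD; ring.
rewrite ler_pM2l ?expR_gt0//.
by have := expR_ge1Dx (- (l * expR u)); lra.
Qed.

Lemma levy_term_mono u : {homo levy_term u : x y / x <= y}.
Proof.
move=> x y xy; rewrite ler_pM2l ?expR_gt0// lerD2l lerN2 ler_expR lerN2.
by rewrite ler_pM2r ?expR_gt0.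
Qed.

(** Source of the self-similarity: scaling [l] by [expR h] only shifts [u] by [h]. *)
Lemma levy_term_scale h u l :
  levy_term u (expR h * l) = expR (h * s) * levy_term (u + h) l.
Proof.
rewrite /levy_term mulrA -expRD; congr (expR _ * (1 - expR (- _))); first by ring.
by rewrite expRD; ring.
Qed.

(** Pairing the indices j and - j - 1 meets every integer exactly once, which turns the two-sided
    sum into an ordinary series. *)
Definition levy_pair h l (j : nat) :=
  levy_term (j%:R * h) l + levy_term (- (j.+1%:R * h)) l.

Lemma levy_pair_ge0 h l j : 0 <= l -> 0 <= levy_pair h l j.
Proof. by move=> l0; rewrite addr_ge0// levy_term_ge0. Qed.

Lemma cvg_expR_nat x : x < 0 -> expR (n%:R * x) @[n --> \oo] --> 0.
Proof.
move=> x0; under eq_fun do rewrite expRM_natl.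
by apply: cvg_expr; rewrite ger0_norm ?expR_ge0// expR_lt1.
Qed.

Lemma is_cvg_levy_series h l : 0 < h -> 0 <= l -> cvgn (series (levy_pair h l)).
Proof.
move=> h0 l0.
(* [v1] dominates the terms of index j and [v2] those of index - j - 1; the factor in front of [v2]
   absorbs the shift by one. *)
pose v1 := geometric 1 (expR (- (h * s))).
pose v2 := geometric (l * expR (- (h * (1 - s)))) (expR (- (h * (1 - s)))).
apply: (@series_le_cvg _ _ (v1 + v2)).
- by move=> j; exact: levy_pair_ge0.
- by move=> j; rewrite addr_ge0// !mulr_ge0 ?exprn_ge0 ?expR_ge0.
- move=> j; rewrite /levy_pair lerD//.
    apply: le_trans (levy_term_le _ _) _; rewrite /v1 /geometric/= mul1r -expRM_natl.
    by rewrite ler_expR; lra.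
  apply: le_trans (levy_term_le_linear _ _) _; rewrite /v2 /geometric/=.
  rewrite -mulrA -exprS -expRM_natl ler_wpM2l// ler_expR.
  by rewrite mulrN mulNr mulrA.
- apply: is_cvg_seriesD; apply: is_cvg_geometric_series;
    rewrite ger0_norm ?expR_ge0// expR_lt1 oppr_lt0 mulr_gt0// subr_gt0//.
Qed.

Lemma cvg_expR_harmonic x : expR (n.+1%:R^-1 * x) @[n --> \oo] --> (1 : R).
Proof.
have cx : n.+1%:R^-1 * x @[n --> \oo] --> 0.
  by rewrite -[X in _ --> X](mul0r x); apply: cvgMr_tmp; exact: cvg_harmonic.
rewrite -[X in _ --> X]expR0.
by apply: (cvg_comp _ _ cx); exact: continuous_expR.
Qed.

Definition levy_sum h l := limn (series (levy_pair h l)).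

Lemma cvg_levy_sum h l : 0 < h -> 0 <= l ->
  series (levy_pair h l) n @[n --> \oo] --> levy_sum h l.
Proof. by move=> h0 l0; exact: is_cvg_levy_series. Qed.

(** The partial sum runs over the indices from - n to n - 1. Shifting them by one gains the index n
    and loses the index - n, whence the two boundary terms. *)
Lemma series_levy_pair_scale h l n :
  series (levy_pair h (expR h * l)) n =
  expR (h * s) * (series (levy_pair h l) n + levy_term (n%:R * h) l
                  - levy_term (- (n%:R * h)) l).
Proof.
elim: n => [|n IH].
  by rewrite !seriesEnat/= !big_geq// mul0r oppr0; ring.
rewrite !seriesSr IH /levy_pair !levy_term_scale.
have -> : n%:R * h + h = n.+1%:R * h by rewrite -natr1; ring.
have -> : - (n.+1%:R * h) + h = - (n%:R * h) by rewrite -natr1; ring.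
rewrite /levy_pair.
move: (series _ _) (levy_term _ _) (levy_term _ _) (levy_term _ _) (levy_term _ _).
move: (expR _) => e a b c d f; ring.
Qed.

Lemma levy_sum_scale h l : 0 < h -> 0 <= l ->
  levy_sum h (expR h * l) = expR (h * s) * levy_sum h l.
Proof.
move=> h0 l0; apply/cvg_lim => //.
rewrite (eq_cvg _ _ (series_levy_pair_scale h l)).
(* Both boundary terms tend to 0: the one at n h by [levy_term_le], the one at - n h by
   [levy_term_le_linear]. *)
apply: cvgMl_tmp; rewrite -[X in _ --> X]addr0 -[X in _ --> X]subr0.
apply: cvgB; first apply: cvgD.
- exact: cvg_levy_sum.
- apply: (@squeeze_cvgr _ _ _ _ (fun=> 0) (fun n => expR (n%:R * - (h * s)))).
  + apply: nearW => n; rewrite levy_term_ge0//=.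
    by apply: le_trans (levy_term_le _ _) _; rewrite ler_expR; lra.
  + exact: cvg_cst.
  + by apply: cvg_expR_nat; rewrite oppr_lt0 mulr_gt0.
- apply: (@squeeze_cvgr _ _ _ _ (fun=> 0)
      (fun n => l * expR (n%:R * - (h * (1 - s))))).
  + apply: nearW => n; rewrite levy_term_ge0//=.
    apply: le_trans (levy_term_le_linear _ _) _.
    by rewrite ler_wpM2l// ler_expR; lra.
  + exact: cvg_cst.
  + rewrite -[X in _ --> X](mulr0 l); apply: cvgMl_tmp; apply: cvg_expR_nat.
    by rewrite oppr_lt0 mulr_gt0// subr_gt0.
Qed.

Lemma levy_sum_scale_nat h l k : 0 < h -> 0 <= l ->
  levy_sum h (expR (k%:R * h) * l) = expR (k%:R * h * s) * levy_sum h l.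
Proof.
move=> h0 l0; elim: k => [|k IH]; first by rewrite !mul0r expR0 !mul1r.
rewrite -natr1 !mulrDl !mul1r !expRD [expR (k%:R * h) * _]mulrC -[in LHS]mulrA.
by rewrite levy_sum_scale ?mulr_ge0 ?expR_ge0// IH; ring.
Qed.

Lemma levy_sum_scale_int h (k : int) : 0 < h ->
  levy_sum h (expR (k%:~R * h)) = expR (k%:~R * h * s) * levy_sum h 1.
Proof.
move=> h0; case: k => k; first by rewrite -levy_sum_scale_nat// mulr1.
(* A negative power is the inverse of a positive one, and scaling this inverse back by the positive
   power gives 1. *)
rewrite NegzE mulrNz !mulNr !expRN; apply: (canRL (mulKf _)); first by rewrite gt_eqF ?expR_gt0.
by rewrite -levy_sum_scale_nat ?invr_ge0 ?expR_ge0// mulfV// gt_eqF// expR_gt0.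
Qed.

Lemma levy_sum_mono h x y : 0 < h -> 0 <= x -> x <= y ->
  levy_sum h x <= levy_sum h y.
Proof.
move=> h0 x0 xy; have y0 := le_trans x0 xy.
apply: ler_lim; [exact: is_cvg_levy_series|exact: is_cvg_levy_series|].
by apply: nearW => n; apply: ler_sum => j _; rewrite lerD// levy_term_mono.
Qed.

Lemma levy_sum0 h : levy_sum h 0 = 0.
Proof.
apply/cvg_lim => //; rewrite (_ : series _ = fun=> 0); first exact: cvg_cst.
apply/funext => n; apply: big1 => j _.
by rewrite /levy_pair /levy_term !mul0r oppr0 expR0 subrr !mulr0 addr0.
Qed.

Lemma levy_sum1_gt0 h : 0 < h -> 0 < levy_sum h 1.
Proof.
move=> h0; apply: (@lt_le_trans _ _ (levy_term 0 1)).
  rewrite mulr_gt0 ?expR_gt0// subr_gt0 expR_lt1 oppr_lt0 mulr_gt0// expR_gt0.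
apply: limr_ge; first exact: is_cvg_levy_series.
near=> n; have n0 : (0 < n)%N by near: n; exact: nbhs_infty_gt.
rewrite seriesEnat/= big_ltn// {1}/levy_pair mul0r -addrA lerDl addr_ge0//.
  exact: levy_term_ge0.
by apply: sumr_ge0 => j _; exact: levy_pair_ge0.
Unshelve. all: by end_near. Qed.

(* Self-similarity determines the sum up to a factor at all powers of [expR h],
   and monotonicity interpolates between two consecutive powers. *)
Lemma levy_sum_approx h l : 0 < h -> 0 < l ->
  `|levy_sum h l / levy_sum h 1 - l `^ s| <= l `^ s * (expR (h * s) - 1).
Proof.
(* With this [k], exp (k h) <= l < exp ((k + 1) h). *)
move=> h0 l0; pose k := Num.floor (ln l / h).
have lE : l = expR (ln l) by rewrite lnK.
have kl : k%:~R * h <= ln l by rewrite -ler_pdivlMr// floor_le_tmp.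
have lk : ln l < k%:~R * h + h.
  rewrite -[X in _ + X]mul1r -mulrDl -ltr_pdivrMr//.
  by rewrite -[X in _ + X]/(1%:~R) -intrD; exact: floorD1_gt.
have p0 := levy_sum1_gt0 _ h0.
have lsE : l `^ s = expR (ln l * s) by rewrite [in LHS]lE -expRM.
have lo : expR (k%:~R * h * s) <= levy_sum h l / levy_sum h 1.
  rewrite ler_pdivlMr// -levy_sum_scale_int// levy_sum_mono ?expR_ge0//.
  by rewrite lE ler_expR.
have hi : levy_sum h l / levy_sum h 1 <= expR (k%:~R * h * s) * expR (h * s).
  rewrite ler_pdivrMr// mulrAC -levy_sum_scale_int// mulrC -levy_sum_scale ?expR_ge0//.
  rewrite -expRD levy_sum_mono//; first exact: ltW.
  by rewrite [leLHS]lE ler_expR addrC ltW.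
have e1 : expR (k%:~R * h * s) <= l `^ s by rewrite lsE ler_expR ler_pM2r.
have e2 : l `^ s <= expR (k%:~R * h * s) * expR (h * s).
  by rewrite lsE -expRD ler_expR -mulrDl ler_pM2r// ltW.
(* The ratio and l^s lie in the same interval from exp (k h s) to exp (k h s) exp (h s). Its length
   is at most l^s (exp (h s) - 1), because exp (k h s) <= l^s. *)
have q0 : 0 <= expR (h * s) - 1 by rewrite subr_ge0 ltW// expR_gt1 mulr_gt0.
have := ler_wpM2r q0 e1.
move: lo hi e1 e2; rewrite ler_norml.
move: (_ / _) (_ `^ _) (expR (h * s)) (expR _) => A B C D lo hi e1 e2 e3.
by apply/andP; split; lra.
Qed.

Lemma cvg_levy_sum_powR l : 0 <= l ->
  levy_sum (k.+1%:R^-1) l / levy_sum (k.+1%:R^-1) 1 @[k --> \oo] --> l `^ s.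
Proof.
rewrite le_eqVlt => /predU1P[<-|l0].
  by under eq_fun do rewrite levy_sum0 mul0r; rewrite powR0 ?gt_eqF//; exact: cvg_cst.
apply/subr_cvg0/norm_cvg0P.
apply: (@squeeze_cvgr _ _ _ _ (fun=> 0)
    (fun k => l `^ s * (expR (k.+1%:R^-1 * s) - 1))).
- apply: nearW => k /=; rewrite normr_ge0/=; apply: levy_sum_approx => //.
- exact: cvg_cst.
- rewrite -[X in _ --> X](mulr0 (l `^ s)); apply: cvgMl_tmp.
  by apply/subr_cvg0; exact: cvg_expR_harmonic.
Qed.

End power_as_exponential_sum.

(** * Multipliers preserving positivity of weighted integrals *)

Lemma cvgn_le_cst {R : realType} (u : nat -> R) (l C : R) :
  u n @[n --> \oo] --> l -> (forall n, u n <= C) -> l <= C.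
Proof.
move=> ul uC; rewrite -(cvg_lim _ ul)//; apply: limr_le; last exact: nearW.
by apply/cvg_ex; exists l.
Qed.

Lemma cvgn_ge_cst {R : realType} (u : nat -> R) (l C : R) :
  u n @[n --> \oo] --> l -> (forall n, C <= u n) -> C <= l.
Proof.
move=> ul uC; rewrite -(cvg_lim _ ul)//; apply: limr_ge; last exact: nearW.
by apply/cvg_ex; exists l.
Qed.

Section positive_integrals.
Context {d} {T : measurableType d} {R : realType}.
Variable mu : {measure set T -> \bar R}.
Implicit Types (f w : T -> R).

Lemma le_integrableR f w : measurable_fun setT f -> (forall x, `|f x| <= w x) ->
  mu.-integrable setT (EFin \o w) -> mu.-integrable setT (EFin \o f).
Proof.
move=> mf fw; apply: le_integrable => //; first exact/measurable_EFinP.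
by move=> x _ /=; rewrite lee_fin (le_trans (fw x))// ler_norm.
Qed.

Lemma integrable_bounded_mul f w : measurable_fun setT f -> (forall x, `|f x| <= 1) ->
  mu.-integrable setT (EFin \o w) ->
  mu.-integrable setT (EFin \o (fun x => f x * w x)).
Proof.
move=> mf f1 intw; have mw : measurable_fun setT w.
  by apply/measurable_EFinP; exact: measurable_int intw.
apply: le_integrable intw => //; first exact/measurable_EFinP/measurable_funM.
by move=> x _ /=; rewrite lee_fin normrM ler_piMl.
Qed.

Lemma cvg_Rintegral_ge0 (f_ : nat -> T -> R) f w :
  (forall n, measurable_fun setT (f_ n)) ->
  mu.-integrable setT (EFin \o w) ->
  (forall n x, `|f_ n x| <= w x) ->
  (forall x, f_ n x @[n --> \oo] --> f x) ->
  (forall n, 0 <= \int[mu]_x f_ n x) -> 0 <= \int[mu]_x f x.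
Proof.
move=> mf_ intw fw ff f0.
have mf : measurable_fun setT f by apply: (measurable_fun_cvg mf_) => x _; exact: ff.
have [|||||intf _ cf] := @dominated_convergence _ _ _ mu setT measurableT
    (fun n => EFin \o f_ n) (EFin \o f) (EFin \o w).
- by move=> n; exact/measurable_EFinP.
- exact/measurable_EFinP.
- by apply: aeW => x _; apply/fine_cvgP; split; [exact: nearW|exact: ff].
- by [].
- by apply: aeW => x n _ /=; rewrite lee_fin.
have ffin : (\int[mu]_x (f x)%:E)%E \is a fin_num by exact: integrable_fin_num.
rewrite /Rintegral; have /fine_cvgP[_ cf'] : 
    (\int[mu]_x (f_ n x)%:E)%E @[n --> \oo] --> (fine (\int[mu]_x (f x)%:E))%:E.
  by rewrite fineK.
exact: (cvgn_ge_cst _ _ _ cf').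
Qed.

End positive_integrals.

Section multipliers.
Context {d} {T : measurableType d} {R : realType}.
(** In the application, [L] is |2 pi xi|^2 and [c] is one of cos <b, xi>, sin <b, xi> and - sin <b,
    xi>. *)
Variables (mu : {measure set T -> \bar R}) (c L : T -> R).
Hypotheses (mc : measurable_fun setT c) (c_le1 : forall x, `|c x| <= 1).
Hypotheses (mL : measurable_fun setT L) (L_ge0 : forall x, 0 <= L x).
Hypothesis int_expL : forall e : R, 0 < e ->
  mu.-integrable setT (fun x => (expR (- (e * L x)))%:E).
Hypothesis expL_ge0 : forall e : R, 0 < e ->
  0 <= \int[mu]_x (c x * expR (- (e * L x))).
Implicit Types (f g psi : T -> R) (s e t a C : R).

Definition bounded_measurable f :=
  measurable_fun setT f /\ exists C, forall x, `|f x| <= C.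

(** The factor in [e] makes the integral converge for every bounded [g], even without decay, so that
    constants can be tested. *)
Definition pos_weight g := bounded_measurable g /\
  forall e, 0 < e -> 0 <= \int[mu]_x (c x * expR (- (e * L x)) * g x).

(** Since multipliers are defined by their action, closure under products is mere composition, with
    no convolution of Fourier transforms. *)
Definition multiplier f := bounded_measurable f /\
  forall g, pos_weight g -> pos_weight (fun x => f x * g x).

Lemma measurable_expL e : measurable_fun setT (fun x => expR (- (e * L x))).
Proof.
apply: measurableT_comp => //; apply: measurableT_comp => //.
exact: measurable_funM.
Qed.

Lemma measurable_weighted e g : measurable_fun setT g ->
  measurable_fun setT (fun x => c x * expR (- (e * L x)) * g x).
Proof.
by move=> mg; apply: measurable_funM => //; apply: measurable_funM => //; exact: measurable_expL.
Qed.

Lemma weighted_le e g C x : `|g x| <= C ->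
  `|c x * expR (- (e * L x)) * g x| <= C * expR (- (e * L x)).
Proof.
move=> gC; rewrite !normrM (ger0_norm (expR_ge0 _)) -mulrA [leRHS]mulrC mulrCA.
rewrite ler_wpM2l ?expR_ge0//; apply: le_trans gC.
by rewrite ler_piMl.
Qed.

Lemma integrable_dominating e C : 0 < e ->
  mu.-integrable setT (EFin \o (fun x => C * expR (- (e * L x)))).
Proof.
by move=> e0; exact: (integrableZl measurableT C (int_expL e e0)).
Qed.

Lemma integrable_weighted e g : 0 < e -> bounded_measurable g ->
  mu.-integrable setT (EFin \o (fun x => c x * expR (- (e * L x)) * g x)).
Proof.
move=> e0 [mg [C gC]]; apply: (le_integrableR mu _ _ _ _ (integrable_dominating e C e0)).
  exact: measurable_weighted.
by move=> x; exact: weighted_le.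
Qed.

Lemma bounded_measurable_cst a : bounded_measurable (fun=> a).
Proof. by split=> //; exists `|a|. Qed.

Lemma bounded_measurableD f g : bounded_measurable f -> bounded_measurable g ->
  bounded_measurable (fun x => f x + g x).
Proof.
move=> [mf [C fC]] [mg [D gD]]; split; first exact: measurable_funD.
by exists (C + D) => x; rewrite (le_trans (ler_normD _ _))// lerD.
Qed.

Lemma bounded_measurableM f g : bounded_measurable f -> bounded_measurable g ->
  bounded_measurable (fun x => f x * g x).
Proof.
move=> [mf [C fC]] [mg [D gD]]; split; first exact: measurable_funM.
by exists (C * D) => x; rewrite normrM ler_pM.
Qed.

Lemma bounded_measurable_cvg (f_ : nat -> T -> R) f C :
  (forall n, bounded_measurable (f_ n)) -> (forall n x, `|f_ n x| <= C) ->
  (forall x, f_ n x @[n --> \oo] --> f x) -> bounded_measurable f.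
Proof.
move=> bf fC ff; split.
  by apply: (measurable_fun_cvg (fun n => (bf n).1)) => x _; exact: ff.
exists C => x; apply: (cvgn_le_cst (fun n => `|f_ n x|)) => //.
by apply: cvg_norm; exact: ff.
Qed.

Lemma pos_weight_cvg (g_ : nat -> T -> R) g C :
  (forall n, pos_weight (g_ n)) -> (forall n x, `|g_ n x| <= C) ->
  (forall x, g_ n x @[n --> \oo] --> g x) -> pos_weight g.
Proof.
move=> pg gC gg; split.
  by apply: (bounded_measurable_cvg g_ _ C) => // n; exact: (pg n).1.
move=> e e0; apply: (cvg_Rintegral_ge0 mu
    (fun n x => c x * expR (- (e * L x)) * g_ n x) _
    (fun x => C * expR (- (e * L x)))) => //.
- by move=> n; apply: measurable_weighted; exact: (pg n).1.1.
- exact: integrable_dominating.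
- by move=> n x; exact: weighted_le.
- by move=> x; apply: cvgMl_tmp; exact: gg.
- by move=> n; exact: (pg n).2.
Qed.

(** The seed to which all multipliers are applied; here the hypothesis [expL_ge0] on Gaussians
    enters. *)
Lemma pos_weight1 : pos_weight (fun=> 1).
Proof.
split; first exact: bounded_measurable_cst.
by move=> e e0; under eq_Rintegral do rewrite mulr1; exact: expL_ge0.
Qed.

Lemma multiplier_cst a : 0 <= a -> multiplier (fun=> a).
Proof.
move=> a0; split; first exact: bounded_measurable_cst.
move=> g [bg pg]; split; first exact: (bounded_measurableM _ _ (bounded_measurable_cst a)).
move=> e e0; under eq_Rintegral do rewrite mulrCA.
by rewrite RintegralZl// ?mulr_ge0 ?pg//; exact: integrable_weighted.
Qed.

Lemma multiplierD f g : multiplier f -> multiplier g ->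
  multiplier (fun x => f x + g x).
Proof.
move=> [bf pf] [bg pg]; split; first exact: bounded_measurableD.
move=> h ph; have [[bfh pfh] [bgh pgh]] := (pf _ ph, pg _ ph); split.
  by apply: bounded_measurableM ph.1; exact: bounded_measurableD.
move=> e e0; under eq_Rintegral do rewrite mulrDl mulrDr.
by rewrite RintegralD ?addr_ge0 ?pfh ?pgh//; exact: integrable_weighted.
Qed.

Lemma multiplierM f g : multiplier f -> multiplier g ->
  multiplier (fun x => f x * g x).
Proof.
move=> [bf pf] [bg pg]; split; first exact: bounded_measurableM.
by move=> h ph; under eq_fun do rewrite -mulrA; exact/pf/pg.
Qed.

Lemma multiplier_cvg (f_ : nat -> T -> R) f C :
  (forall n, multiplier (f_ n)) -> (forall n x, `|f_ n x| <= C) ->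
  (forall x, f_ n x @[n --> \oo] --> f x) -> multiplier f.
Proof.
move=> mf fC ff; split.
  by apply: (bounded_measurable_cvg f_ _ C) => // n; exact: (mf n).1.
move=> g pg; have [_ [D gD]] := pg.1.
apply: (pos_weight_cvg (fun n x => f_ n x * g x) _ (C * D)).
- by move=> n; exact: (mf n).2.
- by move=> n x; rewrite normrM ler_pM.
- by move=> x; apply: cvgMr_tmp; exact: ff.
Qed.

Lemma multiplier_expL a : 0 <= a -> multiplier (fun x => expR (- (a * L x))).
Proof.
move=> a0; have b : bounded_measurable (fun x => expR (- (a * L x))).
  split; first exact: measurable_expL.
  by exists 1 => x; rewrite ger0_norm ?expR_ge0// expR_le1 oppr_le0 mulr_ge0.
split=> // g [bg pg]; split; first exact: bounded_measurableM.
move=> e e0; have := pg (e + a); rewrite ltr_wpDr// => /(_ isT).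
congr (_ <= _); apply: eq_Rintegral => x _.
by rewrite mulrDl opprD expRD; ring.
Qed.

Lemma multiplier_sum (F : nat -> T -> R) n : (forall i, multiplier (F i)) ->
  multiplier (fun x => \sum_(0 <= i < n) F i x).
Proof.
move=> mF; elim: n => [|n IH].
  by under eq_fun do rewrite big_geq//; exact: multiplier_cst.
by under eq_fun do rewrite big_nat_recr//=; exact: multiplierD.
Qed.

Lemma multiplierX f n : multiplier f -> multiplier (fun x => f x ^+ n).
Proof.
move=> mf; elim: n => [|n IH].
  by under eq_fun do rewrite expr0; exact: multiplier_cst.
by under eq_fun do rewrite exprS; exact: multiplierM.
Qed.

(** The partial sums of the exponential series are polynomials in [f] with nonnegative coefficients,
    and they are bounded uniformly by [expR C] when |f| <= C. *)
Lemma multiplier_expR f : multiplier f -> multiplier (fun x => expR (f x)).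
Proof.
move=> mf; have [C fC] := mf.1.2.
apply: (multiplier_cvg (fun n x => series (exp_coeff (f x)) n) _ (expR C)).
- move=> n; apply: multiplier_sum => i; rewrite /exp_coeff/=.
  apply: multiplierM; first exact: multiplierX.
  by apply: multiplier_cst; rewrite invr_ge0 ler0n.
(* The sign of [C] is read off at a point [x], since [T] is not known to be inhabited. *)
- move=> n x; have C0 : 0 <= C by apply: le_trans (fC x).
  apply: (le_trans (ler_norm_sum _ _ _)).
  apply: (@le_trans _ _ (series (exp_coeff C) n)).
    apply: ler_sum => i _; rewrite /exp_coeff/= normrM normfV normr_nat normrX.
    by rewrite ler_pM2r ?invr_gt0 ?ltr0n ?fact_gt0// lerXn2r ?nnegrE.
  apply: nondecreasing_cvgn_le; last exact: is_cvg_series_exp_coeff.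
  by apply: nondecreasing_series => i _ _; exact: exp_coeff_ge0.
- by move=> x; exact: is_cvg_series_exp_coeff.
Qed.

(** The analogue of a negative definite function in the sense of Schoenberg, with multipliers in the
    role of positive definite functions. *)
Definition neg_exponent psi := [/\ measurable_fun setT psi, forall x, 0 <= psi x &
  forall t, 0 <= t -> multiplier (fun x => expR (- (t * psi x)))].

(** The compound Poisson case: exp (- t (1 - g)) = exp (- t) exp (t g), where g = exp (- a L) is a
    multiplier and hence so is exp (t g). *)
Lemma neg_exponent_levy a : 0 <= a -> neg_exponent (fun x => 1 - expR (- (a * L x))).
Proof.
move=> a0; split.
- by apply: measurable_funB => //; exact: measurable_expL.
- by move=> x; rewrite subr_ge0 expR_le1 oppr_le0 mulr_ge0.
- move=> t t0; under eq_fun do rewrite mulrBr mulr1 opprB expRD mulrC.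
  apply: multiplierM; first exact/multiplier_cst/expR_ge0.
  apply: multiplier_expR; apply: multiplierM; first exact: multiplier_cst.
  exact: multiplier_expL.
Qed.

Lemma neg_exponentZ a psi : 0 <= a -> neg_exponent psi ->
  neg_exponent (fun x => a * psi x).
Proof.
move=> a0 [mpsi psi0 h]; split.
- exact: measurable_funM.
- by move=> x; exact: mulr_ge0.
- by move=> t t0; under eq_fun do rewrite mulrA; apply: h; exact: mulr_ge0.
Qed.

Lemma neg_exponentD psi1 psi2 : neg_exponent psi1 -> neg_exponent psi2 ->
  neg_exponent (fun x => psi1 x + psi2 x).
Proof.
move=> [m1 p1 h1] [m2 p2 h2]; split.
- exact: measurable_funD.
- by move=> x; exact: addr_ge0.
- move=> t t0; under eq_fun do rewrite mulrDr opprD expRD.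
  by apply: multiplierM; [exact: h1|exact: h2].
Qed.

Lemma neg_exponent_sum (F : nat -> T -> R) n : (forall i, neg_exponent (F i)) ->
  neg_exponent (fun x => \sum_(0 <= i < n) F i x).
Proof.
move=> hF; elim: n => [|n IH]; last first.
  by under eq_fun do rewrite big_nat_recr//=; exact: neg_exponentD.
under eq_fun do rewrite big_geq//; split=> // t t0.
by under eq_fun do rewrite mulr0 oppr0 expR0; exact: multiplier_cst.
Qed.

(** Nonnegativity of the [F n] bounds all the exponentials by 1, which is the uniform bound that
    [multiplier_cvg] asks for. *)
Lemma neg_exponent_cvg (F : nat -> T -> R) psi : (forall n, neg_exponent (F n)) ->
  (forall x, F n x @[n --> \oo] --> psi x) -> neg_exponent psi.
Proof.
move=> hF Fpsi; split.
- apply: (@measurable_fun_cvg _ _ _ _ F) => [n|x _]; [by have [] := hF n|exact: Fpsi].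
- move=> x; apply: (cvgn_ge_cst _ _ _ (Fpsi x)) => n.
  by have [_ + _] := hF n; exact.
- move=> t t0; apply: (multiplier_cvg (fun n x => expR (- (t * F n x))) _ 1).
  + by move=> n; have [_ _] := hF n; exact.
  + move=> n x; have [_ + _] := hF n => /(_ x) Fx.
    by rewrite ger0_norm ?expR_ge0// expR_le1 oppr_le0 mulr_ge0.
  + move=> x; apply: continuous_cvg; first exact: continuous_expR.
    by apply: cvgN; apply: cvgMl_tmp; exact: Fpsi.
Qed.

Lemma neg_exponent_powR s : 0 < s -> s < 1 -> neg_exponent (fun x => L x `^ s).
Proof.
move=> s0 s1.
have levy u : neg_exponent (fun x => levy_term s u (L x)).
  apply: neg_exponentZ; first exact: expR_ge0.
  by under eq_fun do rewrite [L _ * _]mulrC; apply: neg_exponent_levy; exact: expR_ge0.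
have sum h : 0 < h -> neg_exponent (fun x => levy_sum s h (L x)).
  move=> h0; apply: (neg_exponent_cvg (fun n x => series (levy_pair s h (L x)) n)).
    by move=> n; apply: neg_exponent_sum => i; apply: neg_exponentD; exact: levy.
  by move=> x; exact: cvg_levy_sum.
apply: (neg_exponent_cvg (fun k x =>
    (levy_sum s k.+1%:R^-1 1)^-1 * levy_sum s k.+1%:R^-1 (L x))).
  move=> k; apply: neg_exponentZ; last exact: sum.
  by rewrite invr_ge0 ltW// levy_sum1_gt0.
by move=> x; under eq_fun do rewrite mulrC; exact: cvg_levy_sum_powR.
Qed.

(** The multiplier exp (- t L^s) acts on the weight 1. The auxiliary factor exp (- e L) is then
    removed along e = 1 / (n + 1), with the integrable function exp (- t L^s) itself as the
    dominating function. *)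
Lemma Rintegral_exp_powR_ge0 s t : 0 < s -> s < 1 -> 0 < t ->
  mu.-integrable setT (EFin \o (fun x => expR (- (t * L x `^ s)))) ->
  0 <= \int[mu]_x (c x * expR (- (t * L x `^ s))).
Proof.
move=> s0 s1 t0 intw.
have [mpsi _ /(_ t (ltW t0)) [[mw _] mult]] := neg_exponent_powR s s0 s1.
have [_ pw] := mult _ pos_weight1; apply: (cvg_Rintegral_ge0 mu (fun n x =>
    c x * expR (- (n.+1%:R^-1 * L x)) * expR (- (t * L x `^ s))) _ _ _ intw).
- by move=> n; exact: measurable_weighted.
- move=> n x; rewrite !normrM !(ger0_norm (expR_ge0 _)) ler_piMl ?expR_ge0//.
  rewrite mulr_ile1 ?expR_ge0//.
  by rewrite expR_le1 oppr_le0 mulr_ge0// invr_ge0.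
- move=> x; apply: cvgMr_tmp; rewrite -[X in _ --> X]mulr1; apply: cvgMl_tmp.
  by under eq_fun do rewrite -mulrN; exact: cvg_expR_harmonic.
- move=> n; have := pw n.+1%:R^-1; rewrite invr_gt0 ltr0n => /(_ isT).
  by under eq_Rintegral do rewrite mulr1.
Qed.

End multipliers.

(** * Product integrals and shears *)

Section product_integrals.
Context {d1 d2} {T1 : measurableType d1} {T2 : measurableType d2} {R : realType}.
Variables (m1 : {sigma_finite_measure set T1 -> \bar R})
  (m2 : {sigma_finite_measure set T2 -> \bar R}).
Variables (f : T1 -> R) (g : T2 -> R).
Hypotheses (intf : m1.-integrable setT (EFin \o f))
  (intg : m2.-integrable setT (EFin \o g)).

Lemma integrable_prod :
  (m1 \x m2)%E.-integrable setT (EFin \o (fun z => f z.1 * g z.2)).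
Proof.
have mf : measurable_fun setT f by apply/measurable_EFinP; exact: measurable_int intf.
have mg : measurable_fun setT g by apply/measurable_EFinP; exact: measurable_int intg.
apply/integrable12ltyP.
  apply/measurable_EFinP; apply: measurable_funM.
    exact: measurableT_comp mf measurable_fst.
  exact: measurableT_comp mg measurable_snd.
under eq_integral => x _.
  under eq_integral => y _ do rewrite /= normrM EFinM.
  rewrite ge0_integralZl//; last first.
    by apply/measurable_EFinP; exact: measurableT_comp.
  over.
have [_ ig] := integrableP _ _ _ intg.
have [_ jf] := integrableP _ _ _ intf.
rewrite ge0_integralZr//; last 2 first.
- by apply/measurable_EFinP; exact: measurableT_comp.
- by apply: integral_ge0 => y _; rewrite lee_fin.
rewrite lte_mul_pinfty//.
- exact: integral_ge0.
- by rewrite ge0_fin_numE//; exact: integral_ge0.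
Qed.

Lemma Rintegral_prod :
  \int[(m1 \x m2)%E]_z (f z.1 * g z.2) = (\int[m1]_x f x) * (\int[m2]_y g y).
Proof.
have fg : (\int[m2]_y (g y)%:E)%E \is a fin_num by exact: integrable_fin_num.
have ff : (\int[m1]_y (f y)%:E)%E \is a fin_num by exact: integrable_fin_num.
rewrite /Rintegral -fineM//; congr fine.
rewrite -(integral12_prod_meas1 integrable_prod) /fubini_F/=.
under eq_integral => x _.
  under eq_integral => y _ do rewrite EFinM.
  rewrite integralZl//.
  over.
rewrite -(fineK fg) integralZr//.
Qed.

End product_integrals.

Lemma Rintegral_measure_preserving {d} {T : measurableType d} {R : realType}
    (m : {measure set T -> \bar R}) (phi : T -> T) (f : T -> R) :
  measurable_fun setT phi ->
  (forall A, measurable A -> m (phi @^-1` A) = m A) ->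
  measurable_fun setT f ->
  m.-integrable setT (EFin \o (f \o phi)) ->
  \int[m]_x f (phi x) = \int[m]_x f x.
Proof.
move=> mphi pm mf intf; congr fine.
have mEf : measurable_fun setT (EFin \o f) by exact/measurable_EFinP.
transitivity (\int[pushforward m phi]_x (f x)%:E)%E.
  exact/esym/(integral_pushforward mphi mEf intf measurableT).
pose q := measure_function_pushforward__canonical__measure_function_Measure m mphi.
by apply: (@eq_measure_integral _ _ _ _ m q) => A mA _; exact: pm.
Qed.

(** * Invariance of Lebesgue measure under translations and plane shears *)

Section lebesgue_invariance.
Context {R : realType}.
Local Notation Rm := (measurableTypeR R).
Local Notation mu := (@lebesgue_measure R).

Lemma measurable_translation (a : R) : measurable_fun setT (fun x : Rm => x + a : Rm).
Proof. exact: measurable_funD. Qed.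

(** Lebesgue measure is determined by its values on half-open intervals, whose lengths a translation
    preserves. *)
Lemma lebesgue_measure_translation (a : R) (A : set Rm) : measurable A ->
  mu ((fun x : Rm => x + a : Rm) @^-1` A) = mu A.
Proof.
move=> mA.
pose q := measure_function_pushforward__canonical__measure_function_Measure
  mu (measurable_translation a).
apply/esym/(@lebesgue_measure_unique _ q) => //= _ [[x y]] _ <-.
rewrite /pushforward.
rewrite (_ : _ @^-1` _ = `]x - a, y - a]%classic); last first.
  by apply/seteqP; split => u /=; rewrite !in_itv/= ltrBlDr lerBrDr.
by rewrite !lebesgue_measure_itv/= !lte_fin ltrD2r -!EFinD opprB addrA subrK.
Qed.

Local Notation mu2 := (mu \x mu)%E.

Definition shear1 (phi : Rm -> Rm) (z : Rm * Rm) : Rm * Rm := (z.1 + phi z.2, z.2).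
Definition shear2 (phi : Rm -> Rm) (z : Rm * Rm) : Rm * Rm := (z.1, z.2 + phi z.1).

Variable phi : Rm -> Rm.
Hypothesis mphi : measurable_fun setT phi.

Lemma measurable_shear1 : measurable_fun setT (shear1 phi).
Proof.
apply/measurable_fun_pairP; split; last exact: measurable_snd.
apply: measurable_funD; first exact: measurable_fst.
exact: measurableT_comp mphi measurable_snd.
Qed.

Lemma measurable_shear2 : measurable_fun setT (shear2 phi).
Proof.
apply/measurable_fun_pairP; split; first exact: measurable_fst.
apply: measurable_funD; first exact: measurable_snd.
exact: measurableT_comp mphi measurable_fst.
Qed.

(** On the section above each [x], the shear is the translation by [phi x]. *)
Lemma product_measure_shear2 (A : set (Rm * Rm)) : measurable A ->
  mu2 (shear2 phi @^-1` A) = mu2 A.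
Proof.
move=> mA; apply: eq_integral => x _ /=.
rewrite -[RHS](lebesgue_measure_translation (phi x)); last exact: measurable_xsection.
by congr (mu _); apply/seteqP; split => y /=; rewrite !xsectionE.
Qed.

(** This shear translates the sections at fixed second coordinate, so the product measure is first
    rewritten with the other order of integration. *)
Lemma product_measure_shear1 (A : set (Rm * Rm)) : measurable A ->
  mu2 (shear1 phi @^-1` A) = mu2 A.
Proof.
have mu2E B : measurable B -> mu2 B = (mu \x^ mu)%E B.
  by apply: product_measure_unique => ? ? ? ?; rewrite /= product_measure2E.
move=> mA; rewrite !mu2E//; last first.
  by rewrite -[X in measurable X]setTI; exact: measurable_shear1.
apply: eq_integral => y _ /=.
rewrite -[RHS](lebesgue_measure_translation (phi y)); last exact: measurable_ysection.
by congr (mu _); apply/seteqP; split => x /=; rewrite !ysectionE.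
Qed.

End lebesgue_invariance.

(** * Gaussians on the line *)

Section gaussians_on_the_line.
Context {R : realType}.
Local Notation Rm := (measurableTypeR R).
Local Notation mu := (@lebesgue_measure R).

(** Evenness reduces this to the known integral over the half-line. The function serves as majorant
    for the one-variable integrands below. *)
Lemma integrable_oneDsqrV :
  mu.-integrable setT (EFin \o (fun u : Rm => (oneDsqr u)^-1)).
Proof.
have pos (u : R) : 0 <= (oneDsqr u)^-1 by rewrite invr_ge0 addr_ge0 ?sqr_ge0.
apply/integrableP; split.
  apply/measurable_EFinP; apply: continuous_measurable_fun.
  exact: continuous_oneDsqrV.
under eq_integral do rewrite /= ger0_norm//.
rewrite ge0_symfun_integralT//.
- by rewrite -set_itvcy integral0y_oneDsqr -EFinM ltry.
- exact: continuous_oneDsqrV.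
- by move=> u /=; rewrite /oneDsqr sqrrN.
Qed.

Lemma measurable_exp_powR (k p : R) :
  measurable_fun setT (fun u : Rm => expR (- (k * `|u| `^ p))).
Proof.
apply: measurableT_comp => //; apply: measurableT_comp => //.
apply: measurable_funM => //.
by apply: (measurableT_comp (measurable_powR p)); exact: normr_measurable.
Qed.

(** One term of the exponential series suffices: exp x >= x^(N + 1) / (N + 1)! with x = k y^p, where
    [N] is so large that (N + 1) p >= 2. *)
Lemma exp_powR_le (k p : R) : 0 < k -> 0 < p ->
  exists C, forall u : R, expR (- (k * `|u| `^ p)) <= C * (oneDsqr u)^-1.
Proof.
move=> k0 p0; have [N Np] : exists N, 2 <= N.+1%:R * p.
  exists (Num.truncn (2 / p)); rewrite -ler_pdivrMr// ltW//.
  by apply: truncnS_gt.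
pose D := N.+1`!%:R / k ^+ N.+1.
have D0 : 0 <= D by rewrite divr_ge0// exprn_ge0// ltW.
(* For y = |u| <= 1, the summand 2 bounds 1 + y^2. For y > 1, 1 + y^2 <= 2 y^2 <= 2 D exp (k
   y^p). *)
exists (2 + 2 * D) => u; rewrite ler_pdivlMr; last by rewrite ltr_pwDl ?sqr_ge0.
rewrite expRN ler_pdivrMl ?expR_gt0//.
rewrite /oneDsqr -real_normK ?num_real//; move: `|u| (normr_ge0 u) => y y0.
have x0 : 0 <= k * y `^ p by rewrite mulr_ge0 ?powR_ge0// ltW.
have e1 := expR_ge1Dxn N x0.
have [y1|y1] := leP y 1.
  apply: (@le_trans _ _ 2).
    by rewrite -[leRHS]/(1 + 1) lerD2l expr_le1.
  apply: (@le_trans _ _ (1 * (2 + 2 * D))); first by rewrite mul1r lerDl mulr_ge0.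
  apply: ler_wpM2r; first by apply: addr_ge0 => //; apply: mulr_ge0.
  by rewrite -expR0 ler_expR.
have y2 : y ^+ 2 <= D * expR (k * y `^ p).
  apply: (@le_trans _ _ (D * ((k * y `^ p) ^+ N.+1 / N.+1`!%:R))); last first.
    by rewrite ler_wpM2l//; apply: le_trans e1; rewrite lerDr.
  have -> : D * ((k * y `^ p) ^+ N.+1 / N.+1`!%:R) = (y `^ p) ^+ N.+1.
    rewrite exprMn /D; field.
    by rewrite expf_neq0 ?gt_eqF// pnatr_eq0 -lt0n fact_gt0.
  rewrite -!powR_mulrn ?powR_ge0// -powRrM; apply: ler_powR; first exact: ltW.
  by rewrite mulrC.
have y3 : 1 <= y ^+ 2 by rewrite exprn_ege1// ltW.
have := expR_gt0 (k * y `^ p).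
move: (expR _) y2 => E y2 E0; rewrite mulrDr.
apply: (@le_trans _ _ (E * (2 * D))); last by rewrite lerDr mulr_ge0// ltW.
by nra.
Qed.

Lemma integrable_exp_powR (k p : R) : 0 < k -> 0 < p ->
  mu.-integrable setT (EFin \o (fun u : Rm => expR (- (k * `|u| `^ p)))).
Proof.
move=> k0 p0; have [C eC] := exp_powR_le k p k0 p0.
apply: (le_integrableR mu _ (fun u => C * (oneDsqr u)^-1)).
- exact: measurable_exp_powR.
- by move=> u; rewrite ger0_norm ?expR_ge0//; exact: eC.
- exact: (integrableZl measurableT C integrable_oneDsqrV).
Qed.

Definition gauss (a u : R) := expR (- (a * u ^+ 2)).

Lemma integrable_gauss (a : R) : 0 < a ->
  mu.-integrable setT (EFin \o (gauss a : Rm -> R)).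
Proof.
move=> a0; rewrite (_ : (gauss a : Rm -> R) = fun u => expR (- (a * `|u| `^ 2))).
  exact: integrable_exp_powR.
by apply/funext => u; rewrite /gauss powR_mulrn// real_normK// num_real.
Qed.

Lemma measurable_cosM (b : R) : measurable_fun setT (fun u : Rm => cos (b * u)).
Proof.
apply: continuous_measurable_fun => u.
apply: continuous_comp; [exact: mulrl_continuous|exact: continuous_cos].
Qed.

Lemma measurable_sinM (b : R) : measurable_fun setT (fun u : Rm => sin (b * u)).
Proof.
apply: continuous_measurable_fun => u.
apply: continuous_comp; [exact: mulrl_continuous|exact: continuous_sin].
Qed.

Lemma norm_cos_le1 (u : R) : `|cos u| <= 1.
Proof. by rewrite ler_norml cos_geN1 cos_le1. Qed.

Lemma norm_sin_le1 (u : R) : `|sin u| <= 1.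
Proof. by rewrite ler_norml sin_geN1 sin_le1. Qed.

Lemma integrable_cos_gauss (a b : R) : 0 < a ->
  mu.-integrable setT (EFin \o (fun u : Rm => cos (b * u) * gauss a u)).
Proof.
move=> a0; apply: integrable_bounded_mul; last exact: integrable_gauss.
- exact: measurable_cosM.
- by move=> u; exact: norm_cos_le1.
Qed.

Lemma integrable_sin_gauss (a b : R) : 0 < a ->
  mu.-integrable setT (EFin \o (fun u : Rm => sin (b * u) * gauss a u)).
Proof.
move=> a0; apply: integrable_bounded_mul; last exact: integrable_gauss.
- exact: measurable_sinM.
- by move=> u; exact: norm_sin_le1.
Qed.

(** Comparison with the constant exp (- a) on the unit interval. Strictness permits cancelling this
    integral from a product. *)
Lemma Rintegral_gauss_gt0 (a : R) : 0 < a -> 0 < \int[mu]_u gauss a u.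
Proof.
move=> a0; apply: (@lt_le_trans _ _ (\int[mu]_(u in `[0%R, 1%R]) expR (- a))).
  rewrite Rintegral_cst//= lebesgue_measure_itv/= lte_fin ltr01 oppr0 adde0/=.
  by rewrite mulr1 expR_gt0.
have le_gauss u : ((fun=> expR (- a)) \_ `[0%R, 1%R]) u <= gauss a u.
  rewrite patchE; case: ifPn => [|_]; last exact: expR_ge0.
  rewrite inE/= in_itv/= => /andP[u0 u1]; rewrite ler_expR lerN2 ler_piMr//.
    exact: ltW.
  by rewrite expr_le1.
rewrite Rintegral_mkcond; apply: le_Rintegral => //; last exact: integrable_gauss.
apply: (le_integrableR mu _ (gauss a)); last exact: integrable_gauss.
  exact/(measurable_restrictT _ _).1.
by move=> u; rewrite ger0_norm// patchE; case: ifP => // _; exact: expR_ge0.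
Qed.

(** The integrand is odd and the reflection u -> - u preserves Lebesgue measure, so the integral
    equals its opposite. *)
Lemma Rintegral_sin_gauss (a b : R) : 0 < a ->
  \int[mu]_u (sin (b * u) * gauss a u) = 0.
Proof.
move=> a0; pose f (u : Rm) := sin (b * u) * gauss a u.
have mN : measurable_fun setT (-%R : Rm -> Rm) by exact: oppr_measurable.
have fN : f \o -%R = fun u => -1 * f u.
  by apply/funext => u; rewrite /f /gauss /= mulrN sinN sqrrN; ring.
have intf := integrable_sin_gauss a b a0.
have := Rintegral_measure_preserving mu (-%R : Rm -> Rm) f mN
  (@lebesgue_measureN R).
rewrite -[fun x => f (- x)]/(f \o -%R) fN RintegralZl// -/f.
have intNf : mu.-integrable setT (EFin \o (fun u => -1 * f u)).
  exact: (integrableZl measurableT (-1) intf).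
move=> /(_ _ intNf); have mf : measurable_fun setT f.
  by apply/measurable_EFinP; exact: measurable_int intf.
by move=> /(_ mf); rewrite -/(Rintegral _ _ f); lra.
Qed.

Let shear (z : Rm * Rm) : Rm * Rm := shear2 (fun p => - (p / 2)) (shear1 idfun z).

(* With [p = u + v] and [q = v - p / 2] one has [2 a (u^2 + v^2) = a p^2 + 4 a q^2],
   so that the square of the cosine transform of [gauss (2 a)] is a positive
   multiple of the cosine transform of [gauss a]. *)
Lemma Rintegral_cos_gauss_ge0 (a b : R) : 0 < a ->
  0 <= \int[mu]_u (cos (b * u) * gauss a u).
Proof.
move=> a0; have a20 : 0 < 2 * a by rewrite mulr_gt0.
have a40 : 0 < 4 * a by rewrite mulr_gt0.
pose F (z : Rm * Rm) := cos (b * z.1) * gauss a z.1 * gauss (4 * a) z.2.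
pose cc (z : Rm * Rm) := cos (b * z.1) * gauss (2 * a) z.1 *
  (cos (b * z.2) * gauss (2 * a) z.2).
pose ss (z : Rm * Rm) := sin (b * z.1) * gauss (2 * a) z.1 *
  (sin (b * z.2) * gauss (2 * a) z.2).
have icc : (mu \x mu)%E.-integrable setT (EFin \o cc).
  exact: (integrable_prod mu mu _ _ (integrable_cos_gauss _ b a20)
    (integrable_cos_gauss _ b a20)).
have iss : (mu \x mu)%E.-integrable setT (EFin \o ss).
  exact: (integrable_prod mu mu _ _ (integrable_sin_gauss _ b a20)
    (integrable_sin_gauss _ b a20)).
have iF : (mu \x mu)%E.-integrable setT (EFin \o F).
  exact: (integrable_prod mu mu _ _ (integrable_cos_gauss _ b a0)
    (integrable_gauss _ a40)).
(* [F] is written in the coordinates p and q. The Gaussian exponents agree by the quadratic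
   identity, and the addition formula splits cos (b (u + v)). *)
have FE z : F (shear z) = cc z - ss z.
  case: z => u v; rewrite /F /cc /ss /shear /shear1 /shear2 /gauss /=.
  have -> : cos (b * (u + v)) * expR (- (a * (u + v) ^+ 2)) *
      expR (- (4 * a * (v + - ((u + v) / 2)) ^+ 2)) =
    cos (b * u + b * v) * (expR (- (2 * a * u ^+ 2)) * expR (- (2 * a * v ^+ 2))).
    by rewrite mulrDr -mulrA -!expRD; congr (_ * expR _); field.
  by rewrite cosD; ring.
have mshear : measurable_fun setT shear.
  apply: (measurableT_comp (measurable_shear2 _ _)) => /=.
    by apply: measurableT_comp => //; exact: measurable_funM.
  by apply: measurable_shear1; exact: measurable_id.
have shearE A : measurable A -> (mu \x mu)%E (shear @^-1` A) = (mu \x mu)%E A.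
  move=> mA; have mhalf : measurable_fun setT (fun p : Rm => - (p / 2) : Rm).
    by apply: measurableT_comp => //; exact: measurable_funM.
  pose B := shear2 (fun p : Rm => - (p / 2)) @^-1` A.
  have mB : measurable B.
    by rewrite -[X in measurable X]setTI; exact: measurable_shear2.
  transitivity ((mu \x mu)%E B); last exact: product_measure_shear2.
  by apply: (product_measure_shear1 idfun _ B mB); exact: measurable_id.
have key : (\int[mu]_u (cos (b * u) * gauss a u)) * (\int[mu]_u gauss (4 * a) u) =
    (\int[mu]_u (cos (b * u) * gauss (2 * a) u)) ^+ 2.
  rewrite -(Rintegral_prod mu mu _ _ (integrable_cos_gauss _ b a0)
    (integrable_gauss _ a40)).
  transitivity (\int[(mu \x mu)%E]_z F (shear z)).
    apply/esym/Rintegral_measure_preserving => //.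
      by apply/measurable_EFinP; exact: measurable_int iF.
    rewrite (_ : F \o shear = fun z => cc z - ss z); last exact/funext.
    exact: (integrableB measurableT icc iss).
  under eq_Rintegral do rewrite FE.
  rewrite RintegralB//.
  (* By Fubini the integral of [cc] is the square of the cosine integral, while that of [ss] is the
     square of a sine integral, which vanishes. *)
  rewrite (Rintegral_prod mu mu _ _ (integrable_cos_gauss _ b a20)
    (integrable_cos_gauss _ b a20)).
  rewrite (Rintegral_prod mu mu _ _ (integrable_sin_gauss _ b a20)
    (integrable_sin_gauss _ b a20)).
  by rewrite Rintegral_sin_gauss// mul0r subr0 expr2.
by rewrite -(pmulr_lge0 _ (Rintegral_gauss_gt0 _ a40)) key sqr_ge0.
Qed.

End gaussians_on_the_line.

(** * Gaussians on tuples *)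

Section integrals_on_tuples.
Context {R : realType}.
Local Notation Rm := (measurableTypeR R).
Local Notation mu := (@lebesgue_measure R).
Local Notation mun n := (@lebesgue_tuple R n).

Lemma integrable_tcons n (f : n.+1.-tuple Rm -> R) :
  measurable_fun setT f ->
  (mu \x mun n)%E.-integrable setT (EFin \o (f \o @tcons R n)) ->
  (mun n.+1).-integrable setT (EFin \o f).
Proof.
move=> mf intf; have mEf : measurable_fun setT (EFin \o f) by exact/measurable_EFinP.
exact: (integrable_pushforward (@measurable_tcons R n) mEf intf measurableT).
Qed.

Lemma Rintegral_tcons n (f : n.+1.-tuple Rm -> R) :
  measurable_fun setT f ->
  (mu \x mun n)%E.-integrable setT (EFin \o (f \o @tcons R n)) ->
  \int[mun n.+1]_x f x = \int[(mu \x mun n)%E]_z f (tcons z).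
Proof.
move=> mf intf; have mEf : measurable_fun setT (EFin \o f) by exact/measurable_EFinP.
congr fine.
exact: (integral_pushforward (@measurable_tcons R n) mEf intf measurableT).
Qed.

Lemma measurable_prod_tuple n (f : R -> R) : measurable_fun setT (f : Rm -> R) ->
  measurable_fun setT (fun xi : n.-tuple Rm => \prod_(i < n) f (tnth xi i)).
Proof.
move=> mf; apply: measurable_prod => i _.
by apply: (measurableT_comp mf); exact: measurable_tnth.
Qed.

Lemma integrable_tuple0 (f : 0.-tuple Rm -> R) : (mun 0).-integrable setT (EFin \o f).
Proof.
rewrite (_ : f = cst (f [tuple])); last by apply/funext => x; rewrite /= (tuple0 x).
apply/integrableP; split; first exact/measurable_EFinP/measurable_cst.
rewrite /= integral_cst// [X in (_ * X)%E](_ : _ = 1%E) ?mule1 ?ltry//.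
exact: diracT.
Qed.

Lemma integrable_prod_tuple n (f : R -> R) :
  mu.-integrable setT (EFin \o (f : Rm -> R)) ->
  (mun n).-integrable setT (EFin \o (fun xi => \prod_(i < n) f (tnth xi i))).
Proof.
move=> intf; have mf : measurable_fun setT (f : Rm -> R).
  by apply/measurable_EFinP; exact: measurable_int intf.
elim: n => [|n IH]; first exact: integrable_tuple0.
apply: integrable_tcons; first exact: measurable_prod_tuple.
have := integrable_prod mu (mun n) _ _ intf IH.
congr (integrable _ _ (EFin \o _)); apply/funext => -[u v] /=.
rewrite big_ord_recl; congr (_ * _).
by apply: eq_bigr => i _; rewrite tnthS.
Qed.

Lemma measurable_dotp n (b : n.-tuple R) :
  measurable_fun setT (fun xi : n.-tuple Rm => dotp b xi).
Proof.
apply: measurable_sum => i; apply: measurable_funM => //; exact: measurable_tnth.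
Qed.

Lemma measurable_dotp_diag n : measurable_fun setT (fun xi : n.-tuple Rm => dotp xi xi).
Proof.
by apply: measurable_sum => i; apply: measurable_funM; exact: measurable_tnth.
Qed.

Lemma dotp_tcons n (b : n.+1.-tuple R) (z : Rm * n.-tuple Rm) :
  dotp b (tcons z) = thead b * z.1 + dotp [tuple of behead b] z.2.
Proof.
rewrite /dotp big_ord_recl; congr (_ * _ + _).
apply: eq_bigr => i _; congr (_ * _); last by rewrite tnthS.
by rewrite tnth_behead; congr tnth; apply/val_inj; rewrite /= inordK// ltnS.
Qed.

Lemma dotp_tcons_diag n (z : Rm * n.-tuple Rm) :
  dotp (tcons z) (tcons z) = z.1 ^+ 2 + dotp z.2 z.2.
Proof.
rewrite dotp_tcons theadE expr2; congr (_ + dotp _ _).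
by apply/val_inj.
Qed.

Definition gauss_tuple n (a : R) (xi : n.-tuple Rm) := expR (- (a * dotp xi xi)).

Lemma measurable_gauss_tuple n (a : R) : measurable_fun setT (@gauss_tuple n a).
Proof.
apply: measurableT_comp => //; apply: measurableT_comp => //.
by apply: measurable_funM => //; exact: measurable_dotp_diag.
Qed.

Lemma gauss_tcons n (a : R) (z : Rm * n.-tuple Rm) :
  gauss_tuple n.+1 a (tcons z) = gauss a z.1 * gauss_tuple n a z.2.
Proof. by rewrite /gauss_tuple dotp_tcons_diag mulrDr opprD expRD. Qed.

Lemma integrable_gauss_tuple n (a : R) : 0 < a ->
  (mun n).-integrable setT (EFin \o gauss_tuple n a).
Proof.
move=> a0; have := integrable_prod_tuple n _ (integrable_gauss a a0).
congr (integrable _ _ (EFin \o _)); apply/funext => xi.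
rewrite /gauss_tuple /dotp mulr_sumr -sumrN expR_sum.
by apply: eq_bigr => i _; rewrite /gauss expr2.
Qed.

Lemma measurable_cos_dotp n (b : n.-tuple R) :
  measurable_fun setT (fun xi : n.-tuple Rm => cos (dotp b xi)).
Proof.
apply: measurableT_comp; last exact: measurable_dotp.
by apply: continuous_measurable_fun; exact: continuous_cos.
Qed.

Lemma measurable_sin_dotp n (b : n.-tuple R) :
  measurable_fun setT (fun xi : n.-tuple Rm => sin (dotp b xi)).
Proof.
apply: measurableT_comp; last exact: measurable_dotp.
by apply: continuous_measurable_fun; exact: continuous_sin.
Qed.

(** Induction on [n] with both claims at once, because splitting off the first coordinate by the
    addition formulas mixes sines and cosines. Every product with a sine integral as a factor
    vanishes, which leaves a product of two nonnegative cosine integrals. *)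
Lemma gauss_tuple_fourier n (a : R) (b : n.-tuple R) : 0 < a ->
  0 <= \int[mun n]_xi (cos (dotp b xi) * gauss_tuple n a xi) /\
  \int[mun n]_xi (sin (dotp b xi) * gauss_tuple n a xi) = 0.
Proof.
move=> a0; have intc m (c : m.-tuple R) := integrable_bounded_mul (mun m) _ _
  (measurable_cos_dotp m c) (fun xi => norm_cos_le1 _) (integrable_gauss_tuple m a a0).
have ints m (c : m.-tuple R) := integrable_bounded_mul (mun m) _ _
  (measurable_sin_dotp m c) (fun xi => norm_sin_le1 _) (integrable_gauss_tuple m a a0).
elim: n b => [|n IH] b.
  have d0 (x : 0.-tuple R) : dotp b x = 0 by rewrite /dotp big_ord0.
  split; under eq_Rintegral do rewrite d0.
    by apply: Rintegral_ge0 => x _; rewrite cos0 mul1r expR_ge0.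
  by under eq_Rintegral do rewrite sin0 mul0r; rewrite Rintegral_cst// mul0r.
set b' := [tuple of behead b]; have [cpos s0] := IH b'.
have icc := integrable_prod mu (mun n) _ _ (integrable_cos_gauss a (thead b) a0) (intc n b').
have iss := integrable_prod mu (mun n) _ _ (integrable_sin_gauss a (thead b) a0) (ints n b').
have isc := integrable_prod mu (mun n) _ _ (integrable_sin_gauss a (thead b) a0) (intc n b').
have ics := integrable_prod mu (mun n) _ _ (integrable_cos_gauss a (thead b) a0) (ints n b').
have cE z : cos (dotp b (tcons z)) * gauss_tuple n.+1 a (tcons z) =
    cos (thead b * z.1) * gauss a z.1 * (cos (dotp b' z.2) * gauss_tuple n a z.2) -
    sin (thead b * z.1) * gauss a z.1 * (sin (dotp b' z.2) * gauss_tuple n a z.2).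
  by rewrite dotp_tcons gauss_tcons cosD; ring.
have sE z : sin (dotp b (tcons z)) * gauss_tuple n.+1 a (tcons z) =
    sin (thead b * z.1) * gauss a z.1 * (cos (dotp b' z.2) * gauss_tuple n a z.2) +
    cos (thead b * z.1) * gauss a z.1 * (sin (dotp b' z.2) * gauss_tuple n a z.2).
  by rewrite dotp_tcons gauss_tcons sinD; ring.
split.
- rewrite Rintegral_tcons; first last.
  + apply: eq_integrable (integrableB measurableT icc iss) => // z _.
    by rewrite /= cE.
  + by apply: measurable_funM; [exact: measurable_cos_dotp|exact: measurable_gauss_tuple].
  under eq_Rintegral do rewrite cE.
  rewrite RintegralB//.
  rewrite (Rintegral_prod mu (mun n) _ _ (integrable_cos_gauss a (thead b) a0) (intc n b')).
  rewrite (Rintegral_prod mu (mun n) _ _ (integrable_sin_gauss a (thead b) a0) (ints n b')).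
  by rewrite s0 mulr0 subr0 mulr_ge0// Rintegral_cos_gauss_ge0.
- rewrite Rintegral_tcons; first last.
  + apply: eq_integrable (integrableD measurableT isc ics) => // z _.
    by rewrite /= sE.
  + by apply: measurable_funM; [exact: measurable_sin_dotp|exact: measurable_gauss_tuple].
  under eq_Rintegral do rewrite sE.
  rewrite RintegralD//.
  rewrite (Rintegral_prod mu (mun n) _ _ (integrable_sin_gauss a (thead b) a0) (intc n b')).
  rewrite (Rintegral_prod mu (mun n) _ _ (integrable_cos_gauss a (thead b) a0) (ints n b')).
  by rewrite s0 Rintegral_sin_gauss// mulr0 mul0r addr0.
Qed.

End integrals_on_tuples.

(** * The symbol of the fractional heat operator *)

Lemma dotp_ge0 {R : realType} {n : nat} (x : n.-tuple R) : 0 <= dotp x x.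
Proof. by apply: sumr_ge0 => i _; rewrite -expr2 sqr_ge0. Qed.

Lemma tnth_le_enorm {R : realType} {n : nat} (x : n.-tuple R) i :
  `|tnth x i| <= enorm x.
Proof.
rewrite -sqrtr_sqr ler_sqrt ?dotp_ge0// /dotp (bigD1 i)//= expr2 lerDl.
by apply: sumr_ge0 => j _; rewrite -expr2 sqr_ge0.
Qed.

Lemma dotpZl {R : realType} {n : nat} (a : R) (x y : n.-tuple R) :
  dotp [tuple of map ( *%R a) x] y = a * dotp x y.
Proof.
by rewrite /dotp mulr_sumr; apply: eq_bigr => i _; rewrite tnth_map mulrA.
Qed.

Section symbol.
Context {R : realType}.
Variables (n : nat) (s t : R).
Hypotheses (s_gt0 : 0 < s) (t_gt0 : 0 < t).
Local Notation Rm := (measurableTypeR R).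

Definition symbol (xi : n.-tuple Rm) := expR (- (t * (2 * pi * enorm xi) `^ (2 * s))).

Lemma two_pi_enorm_ge0 (xi : n.-tuple R) : 0 <= 2 * pi * enorm xi.
Proof. by rewrite !mulr_ge0 ?pi_ge0 ?sqrtr_ge0. Qed.

(** The exponent 2 s of the norm becomes the exponent s < 1 of a quadratic form, the shape covered
    by [Rintegral_exp_powR_ge0]. *)
Lemma symbolE (xi : n.-tuple Rm) :
  symbol xi = expR (- (t * ((2 * pi) ^+ 2 * dotp xi xi) `^ s)).
Proof.
congr (expR (- (t * _))); rewrite powRrM; congr (_ `^ s).
by rewrite powR_mulrn ?two_pi_enorm_ge0// exprMn sqr_sqrtr ?dotp_ge0.
Qed.

Lemma measurable_symbol : measurable_fun setT symbol.
Proof.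
rewrite (_ : symbol = fun xi => expR (- (t * ((2 * pi) ^+ 2 * dotp xi xi) `^ s))).
  apply: measurableT_comp => //; apply: measurableT_comp => //.
  apply: measurable_funM => //; apply: (measurableT_comp (measurable_powR s)).
  by apply: measurable_funM => //; exact: measurable_dotp_diag.
by apply/funext => xi; exact: symbolE.
Qed.

(* Each [|xi_i|] is at most [2 * pi * |xi|], so the average of the
   [|xi_i| `^ (2 * s)] bounds the exponent from below and the symbol is dominated
   by a product of functions of one variable. *)
Lemma integrable_symbol : (@lebesgue_tuple R n).-integrable setT (EFin \o symbol).
Proof.
(* Dividing by n + 1 instead of n keeps [k] well defined and positive for n = 0; the sum of n terms
   k y is still at most t y. *)
pose k := t / n.+1%:R; have k0 : 0 < k by rewrite divr_gt0.
have p0 : 0 < 2 * s by rewrite mulr_gt0.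
apply: (le_integrableR _ _ (fun xi : n.-tuple Rm =>
    \prod_(i < n) expR (- (k * `|tnth xi i| `^ (2 * s))))).
- exact: measurable_symbol.
- move=> xi; rewrite ger0_norm ?expR_ge0// -expR_sum ler_expR sumrN lerN2.
  set y := _ `^ _; have y0 : 0 <= y by exact: powR_ge0.
  apply: (@le_trans _ _ (\sum_(i < n) k * y)).
    apply: ler_sum => i _; rewrite ler_pM2l//; apply: ge0_ler_powR.
    + exact: ltW.
    + by rewrite nnegrE.
    + by rewrite nnegrE two_pi_enorm_ge0.
    + apply: le_trans (tnth_le_enorm xi i) _; rewrite ler_peMl ?sqrtr_ge0//.
      by have := @pi_ge2 R; lra.
  rewrite sumr_const card_ord -mulr_natl mulrA ler_wpM2r//.
  by rewrite /k mulrCA ler_piMr ?ltW// ltr_pdivrMr// mul1r ltr_nat.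
- exact: (integrable_prod_tuple n _ (integrable_exp_powR k (2 * s) k0 p0)).
Qed.

(** With L = |2 pi xi|^2, the weight exp (- e L) is the Gaussian of parameter e (2 pi)^2, so testing
    [c] against Gaussians is enough. *)
Lemma Rintegral_symbol_ge0 (c : n.-tuple Rm -> R) : s < 1 ->
  measurable_fun setT c -> (forall xi, `|c xi| <= 1) ->
  (forall a, 0 < a -> 0 <= \int[@lebesgue_tuple R n]_xi (c xi * gauss_tuple n a xi)) ->
  0 <= \int[@lebesgue_tuple R n]_xi (c xi * symbol xi).
Proof.
move=> s1 mc c1 gauss_ge0; pose L (xi : n.-tuple Rm) := (2 * pi) ^+ 2 * dotp xi xi.
have q0 : 0 < (2 * pi) ^+ 2 :> R by rewrite exprn_gt0// mulr_gt0// pi_gt0.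
have gaussE e : (fun xi => expR (- (e * L xi))) = gauss_tuple n (e * (2 * pi) ^+ 2).
  by apply/funext => xi; rewrite /gauss_tuple mulrA.
have symE : symbol = fun xi => expR (- (t * L xi `^ s)).
  by apply/funext => xi; exact: symbolE.
have := integrable_symbol; rewrite symE => intw.
apply: (@Rintegral_exp_powR_ge0 _ _ _ (@lebesgue_tuple R n) c L);
  [exact: mc|exact: c1|..|exact: s_gt0|exact: s1|exact: t_gt0|exact: intw].
- by apply: measurable_funM => //; exact: measurable_dotp_diag.
- by move=> xi; rewrite mulr_ge0 ?dotp_ge0// ltW.
- move=> e e0; have := integrable_gauss_tuple n (e * (2 * pi) ^+ 2).
  by rewrite -gaussE mulr_gt0// => /(_ isT).
- move=> e e0; have := gauss_ge0 (e * (2 * pi) ^+ 2).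
  by rewrite -gaussE mulr_gt0// => /(_ isT).
Qed.

End symbol.

(** * Real and imaginary parts of the heat kernel *)

Lemma cexp_heat_integrand {R : realType} (a b : R) :
  (cexp (- a%:C * 'i) * cexp (- b%:C) = (cos a * expR (- b)) +i* - (sin a * expR (- b)))%C.
Proof.
rewrite /cexp; simpc; rewrite /= expR0 cos0 sin0 cosN sinN.
by congr (_ +i* _)%C; ring.
Qed.

Theorem proposition16p2 (R : realType) (n : nat) (hn : (1 <= n)%N)
  (s : R) (hs0 : 0 < s) (hs1 : s < 1)
  (x : n.-tuple R) (t : R) (ht : 0 < t) :
  0 <= fractional_heat_kernel s x t.
Proof.
(* The factor 2 pi of the phase is absorbed into the frequency vector. *)
pose b := [tuple of map ( *%R (2 * pi)) x].
rewrite /fractional_heat_kernel /cintegral.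
have bE (xi : n.-tuple (measurableTypeR R)) : 2 * pi * dotp x xi = dotp b xi.
  by rewrite dotpZl.
under eq_Rintegral do rewrite bE cexp_heat_integrand /=.
under [X in (_ +i* X)%C]eq_Rintegral do rewrite bE cexp_heat_integrand /=.
have [mc ms] := (measurable_cos_dotp n b, measurable_sin_dotp n b).
have cos1 xi : `|cos (dotp b xi)| <= 1 by exact: norm_cos_le1.
have sin1 xi : `|sin (dotp b xi)| <= 1 by exact: norm_sin_le1.
have ints := integrable_bounded_mul _ _ _ ms sin1 (integrable_symbol n s t hs0 ht).
have sinNE f : (fun xi : n.-tuple (measurableTypeR R) => - sin (dotp b xi) * f xi) =
    (fun xi => -1 * (sin (dotp b xi) * f xi)) by apply/funext => xi; ring.
(* The sine integrals against Gaussians are 0, so positivity transfers to the symbol for both sin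
   and - sin. *)
have sin_ge0 : 0 <= \int[@lebesgue_tuple R n]_xi (sin (dotp b xi) * symbol n s t xi).
  apply: Rintegral_symbol_ge0 => // a a0.
  by rewrite (gauss_tuple_fourier n a b a0).2.
have sin_le0 : 0 <= \int[@lebesgue_tuple R n]_xi (- sin (dotp b xi) * symbol n s t xi).
  apply: (Rintegral_symbol_ge0 n s t hs0 ht (fun xi => - sin (dotp b xi))) => //.
  - exact: measurableT_comp.
  - by move=> xi; rewrite normrN.
  move=> a a0; rewrite sinNE RintegralZl//.
    by rewrite (gauss_tuple_fourier n a b a0).2 mulr0.
  exact: (integrable_bounded_mul _ _ _ ms sin1 (integrable_gauss_tuple n a a0)).
move: sin_le0; rewrite sinNE RintegralZl// mulN1r oppr_ge0 => sin_le0.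
(* The order on [R[i]] compares only numbers with equal imaginary parts, so the sine integral must
   vanish exactly. *)
rewrite lecE /=; apply/andP; split.
  rewrite (_ : Rintegral _ _ _ = - \int[@lebesgue_tuple R n]_xi
      (sin (dotp b xi) * symbol n s t xi)).
    by rewrite oppr_eq0 eq_le sin_le0 sin_ge0.
  by rewrite -mulN1r -RintegralZl//; apply: eq_Rintegral => xi _; rewrite mulN1r.
apply: Rintegral_symbol_ge0 => // a a0.
exact: (gauss_tuple_fourier n a b a0).1.
Qed.
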